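(* For every integer $n\ge 4$, let $c_n$ denote the minimum number of edges in an OT-graph for a set of $n$ points in convex position in the plane. Then $c_n\le \lfloor 2n/3\rfloor$.
   Context: Point sets are finite sets of points in the plane in general position (no three collinear). For distinct points $p,q,r$, write $pqr$ for the statement ''the ordered triple $(p,q,r)$ has counterclockwise (CCW) orientation'' and $\lnot pqr$ for the statement that it does not (i.e. it is clockwise). Consider the following axioms (for distinct points), used as inference rules: Axiom 1 (cyclic symmetry): $pqr\implies qrp$. Axiom 2 (antisymmetry): $pqr\implies \lnot prq$. Axiom 3' (nondegeneracy): $\lnot pqr\implies prq$. Axiom 4 (interiority): $tqr\land ptr\land pqt\implies pqr$. Axiom 5 (transitivity): $tsp\land tsq\land tsr\land tpq\land tqr\implies tpr$. Let $G$ be a graph with vertex set a point set $S$, and let $T$ be the set of triples $abc$ of distinct points of $S$ such that at least one of $ab$, $ac$, $bc$ is an edge of $G$, each triple taken together with its true orientation in the plane. $G$ is an OT-graph for $S$ if the orientation of every triple of distinct points of $S$ can be derived from the orientations of the triples in $T$ by (repeatedly) applying Axioms 1, 2, 3', 4 and 5. *)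

(* Defs.v *)
(* The plane is R^2 for an arbitrary R : realType. *)
From HB Require Import structures.
From mathcomp Require Import all_boot all_order all_algebra.
From mathcomp Require Import finmap.
From mathcomp Require Import reals.

Set Implicit Arguments.
Unset Strict Implicit.
Unset Printing Implicit Defensive.

Import Order.TTheory GRing.Theory Num.Theory.
Local Open Scope fset_scope.
Local Open Scope ring_scope.

Section Plane.
Variable R : realType.
Local Notation point := 'rV[R]_2.

(* Twice the signed area of the triangle pqr. *)
Definition area2 (p q r : point) : R :=
  (q 0 0 - p 0 0) * (r 0 1 - p 0 1) - (q 0 1 - p 0 1) * (r 0 0 - p 0 0).

Definition ccw (p q r : point) : bool := 0 < area2 p q r.

Definition collinear (p q r : point) : bool := area2 p q r == 0.

Definition general_position (S : {fset point}) : Prop :=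
  forall p q r, p \in S -> q \in S -> r \in S ->
    uniq [:: p; q; r] -> ~~ collinear p q r.

Definition in_convex_hull (A : {fset point}) (x : point) : Prop :=
  exists w : point -> R,
    [/\ {in A, forall a, 0 <= w a},
        \sum_(a <- A) w a = 1 &
        \sum_(a <- A) w a *: a = x].

Definition convex_position (S : {fset point}) : Prop :=
  forall p, p \in S -> ~ in_convex_hull (S `\ p) p.

End Plane.

(* [derivable T a b c true] stands for "abc is derivable from T", and
   [derivable T a b c false] for "(not abc) is derivable from T".  The axioms
   are used only in the direction in which they are displayed, and only on
   distinct points. *)
Inductive derivable (V : eqType) (T : V -> V -> V -> bool -> Prop) :
    V -> V -> V -> bool -> Prop :=
| derivable_given a b c o : T a b c o -> derivable T a b c o
| cyclic_symmetry p q r : uniq [:: p; q; r] ->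
    derivable T p q r true -> derivable T q r p true
| antisymmetry p q r : uniq [:: p; q; r] ->
    derivable T p q r true -> derivable T p r q false
| nondegeneracy p q r : uniq [:: p; q; r] ->
    derivable T p q r false -> derivable T p r q true
| interiority t p q r : uniq [:: t; p; q; r] ->
    derivable T t q r true -> derivable T p t r true ->
    derivable T p q t true -> derivable T p q r true
| transitivity t s p q r : uniq [:: t; s; p; q; r] ->
    derivable T t s p true -> derivable T t s q true ->
    derivable T t s r true -> derivable T t p q true ->
    derivable T t q r true -> derivable T t p r true.

Section OTGraph.
Variables (R : realType) (S : {fset 'rV[R]_2}).

(* A simple graph with vertex set S is given by its set of edges, an edge being
   a 2-element set of vertices. *)
Definition is_graph (E : {set {set S}}) : Prop :=
  forall e, e \in E -> #|e| = 2%N.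

Definition given_orientation (E : {set {set S}}) (a b c : S) (o : bool) : Prop :=
  [/\ uniq [:: a; b; c],
      [|| [set a; b] \in E, [set a; c] \in E | [set b; c] \in E] &
      o = ccw (val a) (val b) (val c)].

Definition OT_graph (E : {set {set S}}) : Prop :=
  is_graph E /\
  forall a b c : S, uniq [:: a; b; c] ->
    derivable (given_orientation E) a b c (ccw (val a) (val b) (val c)).

Definition min_OT_edges (k : nat) : Prop :=
  (exists2 E : {set {set S}}, OT_graph E & #|E| = k) /\
  (forall E : {set {set S}}, OT_graph E -> (k <= #|E|)%N).

End OTGraph.

Definition convex_point_set (R : realType) (n : nat) (S : {fset 'rV[R]_2}) :
    Prop :=
  [/\ #|` S| = n, general_position S & convex_position S].

(* [is_cn R n c] says that c is the number c_n: the minimum size of an OT-graph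
   does not depend on the choice of the n points in convex position, and its
   common value is c.  The first clause makes c unique. *)
Definition is_cn (R : realType) (n c : nat) : Prop :=
  (exists S : {fset 'rV[R]_2}, convex_point_set n S) /\
  (forall S : {fset 'rV[R]_2}, convex_point_set n S -> min_OT_edges S c).

(* Main.v *)
Require Import Defs.
From mathcomp Require Import all_boot all_order all_algebra reals.
From mathcomp Require Import finmap boolp.
From mathcomp Require Import zify ring lra.

(* Label the points 0, ..., n-1 in cyclic order.  In convex position the only
   useful axiom is transitivity: if t, s, p, q, r are in cyclic order, then tpr
   follows from the other five triples through t.  If ts is an edge, or more
   generally if every triple through t and s is known ("s dominates at t"), it
   composes tpq and tqr into tpr, so orientations propagate along paths.

   When n is not 1 mod 3 the graph is the path 0, 1, 3, 4, 6, 7, ..., n-1, which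
   leaves the vertices congruent to 2 mod 3 isolated (except n-1).  When n is
   1 mod 3 this graph is taken on the first n-2 points, together with one edge
   between the last two.  At an isolated vertex u the successor u+1 dominates:
   u+1 is joined to u+2, which dominates at u+1, and u-1 is joined to u+1, so
   every triple (u+1, x, u) is obtained with p = x and q = u-1.

   Orientation-preserving bijections transport OT-graphs, so c_n may be computed
   on n points of a parabola. *)

Set Implicit Arguments.
Unset Strict Implicit.
Unset Printing Implicit Defensive.

(** * Propagation along the graph *)

Definition cyc (i j k : nat) : bool := [|| i < j < k, j < k < i | k < i < j].

(* [D x y z] stands for "the orientation of xyz is derivable". *)
Section Propagation.
Variables (n L : nat) (D : nat -> nat -> nat -> Prop).
Hypothesis D_rot : forall x y z, D x y z -> D y z x.
Hypothesis D_swap : forall x y z, D x y z -> D x z y.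
Hypothesis D_trans : forall t s p q r,
  t < n -> s < n -> p < n -> q < n -> r < n ->
  cyc t s p -> cyc t p q -> cyc t q r ->
  D t s p -> D t s q -> D t s r -> D t p q -> D t q r -> D t p r.

Definition dominates t s := forall x, x < n -> x != t -> x != s -> D t s x.

Hypothesis L_ge2 : 2 <= L.
Hypothesis L_mod3 : L %% 3 != 1.
Hypothesis n_cases : n = L \/ n = L.+2.
Hypothesis edge1 : forall x, x %% 3 = 0 -> x.+1 < L -> dominates x x.+1.
Hypothesis edge2 : forall x, x %% 3 = 1 -> x.+2 < L -> dominates x x.+2.
(* For [L] divisible by 3 the pattern is cut short at [L - 1]. *)
Hypothesis edge_end : L %% 3 = 0 -> dominates (L - 2) (L - 1).
Hypothesis edge_extra : n = L.+2 -> dominates L L.+1.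

(** The bound [u.+1 < L] keeps [L - 1] on the path when 3 divides [L]; the path then ends with the
    edge from [L - 2] to [L - 1]. *)
Definition skipped u := (u.+1 < L) && (u %% 3 == 2).
Definition on_path x := (x < L) && ~~ skipped x.

Lemma D213 x y z : D x y z -> D y x z. Proof. by move=> h; apply/D_swap/D_rot. Qed.
Lemma D312 x y z : D x y z -> D z x y. Proof. by move=> h; apply/D_rot/D_rot. Qed.
Lemma D321 x y z : D x y z -> D z y x. Proof. by move=> h; apply/D_swap/D312. Qed.

Lemma dominates_sym t s : dominates t s -> dominates s t.
Proof. by move=> h x xn xs xt; apply/D213/h. Qed.

(** * Triples of path vertices *)

Lemma path_next x : on_path x -> x.+1 < L -> exists s,
  [/\ on_path s, x < s, dominates x s, s < x.+3 &
     forall y, on_path y -> x < y -> s <= y].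
Proof.
rewrite /on_path /skipped => px xL.
have [x0|x0] := eqVneq (x %% 3) 0.
  by exists x.+1; split; [lia|lia|exact: edge1|lia|lia].
have x1 : x %% 3 = 1 by lia.
have [xL'|xL'] := ltnP x.+2 L.
  by exists x.+2; split; [lia|lia|exact: edge2|lia|lia].
exists x.+1; split; [lia|lia| |lia|lia].
(* Here [x] is 1 mod 3 and [L = x.+2], so 3 divides [L] and this is the truncated last edge. *)
have [-> ->] : x = L - 2 /\ x.+1 = L - 1 by lia.
by apply: edge_end; lia.
Qed.

(** Induction on [y - x]: the edge from [x] to its path successor [q] gives [D t x q], induction
    gives [D t q y], and [s] composes them. With [t] outside the interval from [x] to [y], the
    labels [t], [s], [x], [q], [y] are in cyclic order. *)
Lemma path_chain t s x y : on_path x -> on_path y -> x < y -> t < n -> s < n ->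
  (t < x) || (y < t) -> cyc t s x -> dominates t s -> D t x y.
Proof.
move=> px py xy tn sn txy tsx dom; have [k] := ubnP (y - x).
elim: k x px xy txy tsx => // k IH x px xy txy tsx lek.
have [|q [pq xq domx _ min]] := path_next px; first by move: py; rewrite /on_path; lia.
have := min y py xy; rewrite leq_eqVlt => /orP[/eqP qy|qy].
  by subst q; apply/D312/domx; lia.
have [x' y'] : x < L /\ y < L by move: px py; rewrite /on_path; lia.
have cq : cyc t s q by move: tsx txy; rewrite /cyc; lia.
apply: (@D_trans t s x q y) => //; try (move: tsx txy; rewrite /cyc; lia).
- by apply: dom; move: tsx; rewrite /cyc; lia.
- by apply: dom; move: tsx txy; rewrite /cyc; lia.
- by apply: dom; move: tsx txy; rewrite /cyc; lia.
- by apply/D312/domx; lia.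
- by apply: IH => //; lia.
Qed.

(** The path successor of [x] dominates at [x], so the chain from [y] to [z] is seen from the apex
    [x]. *)
Lemma path3 x y z : on_path x -> on_path y -> on_path z -> x < y < z -> D x y z.
Proof.
move=> px py pz xyz; have zL : z < L by move: pz; rewrite /on_path; lia.
have [|s [ps xs dom _ min]] := path_next px; first lia.
have xy : x < y by lia.
have := min y py xy; rewrite leq_eqVlt => /orP[/eqP sy|sy]; first by subst s; apply: dom; lia.
by apply: (@path_chain x s) => //; rewrite /cyc; lia.
Qed.

Lemma path3_any x y z : on_path x -> on_path y -> on_path z ->
  x != y -> y != z -> x != z -> D x y z.
Proof.
move=> px py pz xy yz xz.
have [h|h] := ltnP x y; have [h'|h'] := ltnP y z; have [h''|h''] := ltnP x z; try lia.
- by apply: path3; lia.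
- by apply/D_swap/path3; lia.
- by apply/D_rot/path3; lia.
- by apply/D213/path3; lia.
- by apply/D312/path3; lia.
- by apply/D321/path3; lia.
Qed.

(** * Triples with skipped vertices *)

Lemma skip_next u x : skipped u -> x < n -> x != u -> x != u.+1 -> D u.+1 u x.
Proof.
rewrite /skipped => su xn xu xc.
have dbc : dominates (u - 1) u.+1.
  have -> : u.+1 = (u - 1).+2 by lia.
  by apply: edge2; lia.
(* The edge exists because [L = u.+2] would make [L] congruent to 1 mod 3. *)
have dcd : dominates u.+1 u.+2 by apply: edge1; lia.
have [->|xb] := eqVneq x (u - 1); first by apply/D_rot/dbc; lia.
have [->|xd] := eqVneq x u.+2; first by apply/D_swap/dcd; lia.
apply/D_swap/(@D_trans u.+1 u.+2 x (u - 1) u); rewrite /cyc; try lia.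
- by apply: dcd; lia.
- by apply: dcd; lia.
- by apply: dcd; lia.
- by apply/D_swap/dominates_sym => //; lia.
- by apply/dominates_sym => //; lia.
Qed.

Lemma skip_dom u : skipped u -> dominates u u.+1.
Proof. by move=> su x xn xu xc; apply/D213/skip_next. Qed.

Lemma skip_chain u x y : skipped u -> on_path x -> on_path y -> x < y ->
  (u < x) || (y < u) -> D u x y.
Proof.
move=> su px py xy uxy.
have [yL uL] : y < L /\ u.+1 < L by move: py su; rewrite /on_path /skipped; lia.
have [->|xc] := eqVneq x u.+1; first by apply: skip_dom => //; lia.
by apply: (@path_chain u u.+1) => //; rewrite /cyc ?skip_dom //; try lia; exact: skip_dom.
Qed.

(** The path successor of [x] is at most [u - 1], hence precedes [u]; at the apex [x] it composes
    the steps from [u] to [u.+1] and from [u.+1] to [y]. The case [y = L] serves the extra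
    points. *)
Lemma skip_between_far u x y : skipped u -> on_path x -> x < u - 1 ->
  on_path y || (y == L) && (n == L.+2) -> u < y ->
  (y != u.+1 -> D x u.+1 y) -> D x u y.
Proof.
move=> su px xb py uy Dxcy.
have uL : u.+1 < L by move: su; rewrite /skipped; lia.
have yn : y < n by move: py; rewrite /on_path; lia.
have pb : on_path (u - 1) by move: su; rewrite /on_path /skipped; lia.
have [|s [ps xs dom _ min]] := path_next px; first lia.
have sb : s <= u - 1 by apply: min.
have [->|yc] := eqVneq y u.+1; first by apply/D312/skip_dom; lia.
apply: (@D_trans x s u u.+1 y); rewrite /cyc; try lia.
- by apply: dom; lia.
- by apply: dom; lia.
- by apply: dom; lia.
- by apply/D312/skip_dom; lia.
- exact: Dxcy.
Qed.

(* Going around [u] from [y] to [u - 1] through the vertex 0. *)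
Lemma skip_wrap u y : skipped u -> y < n -> u.+1 < y -> D 0 u y -> D u y (u - 1).
Proof.
move=> su yn uy D0.
have [u0 uL] : 2 <= u /\ u.+1 < L by move: su; rewrite /skipped; lia.
have p0 : on_path 0 by rewrite /on_path /skipped; lia.
have pb : on_path (u - 1) by move: su; rewrite /on_path /skipped; lia.
apply: (@D_trans u u.+1 y 0 (u - 1)); rewrite /cyc; try lia.
- by apply: skip_dom; lia.
- by apply: skip_dom; lia.
- by apply: skip_dom; lia.
- exact: D_rot.
- by apply: skip_chain => //; lia.
Qed.

(** If [u] lies between [x] and [y], the apex [x] works unless [x = u - 1], whose path successor
    [u.+1] is already past [u]. In that case the apex is [u] and the chain wraps around through
    0. *)
Lemma skip_path2 u x y : skipped u -> on_path x -> on_path y -> x != y -> D u x y.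
Proof.
move=> su; wlog xy : x y / x < y.
  move=> h px py nxy; have [xy|yx] := ltnP x y; first exact: h.
  by apply/D_swap/h => //; lia.
move=> px py _; have [yL uL] : y < L /\ u.+1 < L.
  by move: py su; rewrite /on_path /skipped; lia.
have [xu yu] : x != u /\ y != u by move: px py su; rewrite /on_path /skipped; lia.
have [out|/norP[xu' yu']] := boolP ((u < x) || (y < u)); first exact: skip_chain.
have pc : on_path u.+1 by move: su; rewrite /on_path /skipped; lia.
have p0 : on_path 0 by rewrite /on_path /skipped; lia.
have far z : on_path z -> z < u - 1 -> D z u y.
  move=> pz zb; apply: skip_between_far; rewrite ?py //; first lia.
  by move=> yc; apply: path3 => //; lia.
have [xb|xb] := eqVneq x (u - 1); last by apply/D213/far => //; lia.
have [->|yc] := eqVneq y u.+1; first by apply/D_swap/skip_dom => //; lia.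
rewrite xb; apply/D_swap/skip_wrap => //; try lia.
by apply: far => //; move: su; rewrite /skipped; lia.
Qed.

(** At the apex [v], dominated by [v.+1], the chain goes from [u] to [u.+1] and on to [v - 1].
    Skipped vertices differ by a multiple of 3, which keeps these five labels in cyclic order. *)
Lemma skip_pred u v : skipped u -> skipped v -> u != v -> D u v (v - 1).
Proof.
move=> su sv uv; have pc : on_path u.+1 by move: su; rewrite /on_path /skipped; lia.
have pb : on_path (v - 1) by move: sv; rewrite /on_path /skipped; lia.
have [uL vL v2] : [/\ u.+1 < L, v.+1 < L & 2 <= v].
  by split; move: su sv; rewrite /skipped; lia.
have cb : u.+1 != v - 1 by move: su sv; rewrite /skipped; lia.
have cv : u.+1 < v \/ v.+1 < u by move: su sv; rewrite /skipped; lia.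
apply/D213/(@D_trans v v.+1 u u.+1 (v - 1)); rewrite /cyc; try lia.
- by apply: skip_dom; lia.
- by apply: skip_dom; lia.
- by apply: skip_dom; lia.
- by apply/D312/skip_dom; lia.
- exact: skip_path2.
Qed.

(** At the apex [u], the chain joins [v] to [x] through [v - 1] if [x] comes before [v] going around
    from [u], and through [v.+1] otherwise. The remaining step is assumed, so that [x] may be on the
    path or skipped. *)
Lemma skip2 u v x : skipped u -> skipped v -> u != v -> x < n ->
  x != u -> x != v -> (x != v - 1 -> D u x (v - 1)) ->
  (x != v.+1 -> D u v.+1 x) -> D u v x.
Proof.
move=> su sv uv xn xu xv Db Dc.
have [->|xb] := eqVneq x (v - 1); first exact: skip_pred.
have [uL vL v2] : [/\ u.+1 < L, v.+1 < L & 2 <= v].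
  by split; move: su sv; rewrite /skipped; lia.
have uv2 : u.+1 < v - 1 \/ v.+1 < u by move: su sv; rewrite /skipped; lia.
have [->|xc] := eqVneq x v.+1; first by apply/D_rot/D_rot/skip_dom; lia.
have [->|xd] := eqVneq x u.+1; first by apply/D_swap/skip_dom; lia.
have dom := skip_dom su.
have [c|c] := boolP (cyc u x v).
  apply/D_swap/(@D_trans u u.+1 x (v - 1) v); move: c; rewrite /cyc; try lia.
  - by move=> _; apply: dom; lia.
  - by move=> _; apply: dom; lia.
  - by move=> _; apply: dom; lia.
  - by move=> _; apply: Db.
  - by move=> _; apply/D_swap/skip_pred.
apply: (@D_trans u u.+1 v v.+1 x); move: c; rewrite /cyc; try lia.
- by move=> _; apply: dom; lia.
- by move=> _; apply: dom; lia.
- by move=> _; apply: dom; lia.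
- by move=> _; apply/D312/skip_dom; lia.
- by move=> _; apply: Dc.
Qed.

Lemma skip2_path u v x : skipped u -> skipped v -> u != v -> on_path x -> D u v x.
Proof.
move=> su sv uv px.
have [xu xv] : x != u /\ x != v by move: px su sv; rewrite /on_path /skipped; lia.
have pb : on_path (v - 1) by move: sv; rewrite /on_path /skipped; lia.
have pc : on_path v.+1 by move: sv; rewrite /on_path /skipped; lia.
have xn : x < n by move: px; rewrite /on_path; lia.
apply: skip2 => // h; apply: skip_path2 => //; lia.
Qed.

Lemma skip3 u v w : skipped u -> skipped v -> skipped w ->
  u != v -> v != w -> u != w -> D u v w.
Proof.
move=> su sv sw uv vw uw.
have pb : on_path (v - 1) by move: sv; rewrite /on_path /skipped; lia.
have pc : on_path v.+1 by move: sv; rewrite /on_path /skipped; lia.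
have wn : w < n by move: sw; rewrite /skipped; lia.
apply: skip2 => //; try lia; move=> h; last apply: D_swap; exact: skip2_path.
Qed.

Lemma block_triple x y z : x < L -> y < L -> z < L -> x != y -> y != z -> x != z ->
  D x y z.
Proof.
move=> xL yL zL xy yz xz.
have dec v : v < L -> skipped v \/ on_path v.
  by move=> vL; rewrite /on_path vL; case: skipped; [left|right].
have [yx zy zx] : [/\ y != x, z != y & z != x] by rewrite ![_ == x]eq_sym ![z == y]eq_sym.
have [sx|px] := dec x xL; have [sy|py] := dec y yL; have [sz|pz] := dec z zL.
- exact: skip3.
- exact: skip2_path.
- by apply/D_swap/skip2_path.
- exact: skip_path2.
- by apply/D312/skip2_path.
- by apply/D213/skip_path2.
- by apply/D_rot/skip_path2.
- exact: path3_any.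
Qed.

(** * Triples with the two extra points *)

Lemma extra1_path x y : n = L.+2 -> on_path x -> on_path y -> x != y -> D L x y.
Proof.
move=> nL; wlog xy : x y / x < y.
  move=> h px py nxy; have [xy|yx] := ltnP x y; first exact: h.
  by apply/D_swap/h => //; lia.
move=> px py _; have yL : y < L by move: py; rewrite /on_path; lia.
by apply: (@path_chain L L.+1) => //; rewrite /cyc; try lia; exact: edge_extra.
Qed.

Lemma extra_pred u y : n = L.+2 -> L <= y < n -> skipped u ->
  D 0 u y -> D y (u - 1) u.
Proof.
move=> nL yn su D0; apply/D_rot/skip_wrap => //; first lia.
by move: su; rewrite /skipped; lia.
Qed.

Lemma extra0 u : n = L.+2 -> skipped u -> D 0 u L.
Proof.
move=> nL su; have p0 : on_path 0 by rewrite /on_path /skipped; lia.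
have [u2 uL] : 2 <= u /\ u.+1 < L by move: su; rewrite /skipped; lia.
have pc : on_path u.+1 by move: su; rewrite /on_path /skipped; lia.
apply: skip_between_far => //; rewrite ?nL ?eqxx ?orbT //; try lia.
by move=> _; apply/D_rot/extra1_path.
Qed.

(** At the apex [L] the last point [L.+1] dominates and composes the steps from [v] to [u - 1] and
    from [u - 1] to [u]. It is applied both to path vertices and to skipped [v]. *)
Lemma extra1_from_pred u v : n = L.+2 -> skipped u -> v < u - 1 ->
  D L v (u - 1) -> D L v u.
Proof.
move=> nL su vb Dv.
have [u2 uL] : 2 <= u /\ u.+1 < L by move: su; rewrite /skipped; lia.
have domL := edge_extra nL.
apply: (@D_trans L L.+1 v (u - 1) u); rewrite /cyc; try lia.
- by apply: domL; lia.
- by apply: domL; lia.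
- by apply: domL; lia.
- exact: Dv.
- by apply: extra_pred => //; [lia | exact: extra0].
Qed.

Lemma extra1_skip u v : n = L.+2 -> skipped u -> on_path v -> D L v u.
Proof.
move=> nL su pv.
have [u2 uL] : 2 <= u /\ u.+1 < L by move: su; rewrite /skipped; lia.
have pb : on_path (u - 1) by move: su; rewrite /on_path /skipped; lia.
have pc : on_path u.+1 by move: su; rewrite /on_path /skipped; lia.
have [vL vu] : v < L /\ v != u by move: pv su; rewrite /on_path /skipped; lia.
have domL := edge_extra nL.
have [->|vb] := eqVneq v (u - 1).
  by apply: extra_pred => //; [lia | exact: extra0].
have [->|vc] := eqVneq v u.+1; first by apply/D321/skip_dom; lia.
have [vu'|vu'] := ltnP v u.
  by apply: extra1_from_pred => //; [lia | exact: extra1_path].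
apply/D_swap/(@D_trans L L.+1 u u.+1 v); rewrite /cyc; try lia.
- by apply: domL; lia.
- by apply: domL; lia.
- by apply: domL; lia.
- by apply/D312/skip_dom; lia.
- by apply: extra1_path => //; lia.
Qed.

Lemma extra1_block x y : n = L.+2 -> x < L -> y < L -> x < y -> D L x y.
Proof.
move=> nL xL yL xy.
have dec v : v < L -> skipped v \/ on_path v.
  by move=> vL; rewrite /on_path vL; case: skipped; [left|right].
have [sx|px] := dec x xL; have [sy|py] := dec y yL.
- have pb : on_path (y - 1) by move: sy; rewrite /on_path /skipped; lia.
  apply: extra1_from_pred => //; first by move: sx sy; rewrite /skipped; lia.
  by apply/D_swap/extra1_skip.
- by apply/D_swap/extra1_skip.
- exact: extra1_skip.
- by apply: extra1_path => //; lia.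
Qed.

(** Seen from [L.+1], the point [L] comes last in cyclic order, so transitivity cannot use it as
    [s]. The apex is [x] instead, and the chain from [w] to [L.+1] passes through [L]. *)
Lemma extra2_apex x s w : n = L.+2 -> x < s -> s < w -> w < L ->
  dominates x s -> D x w L.+1.
Proof.
move=> nL xs sw wL dom; apply: (@D_trans x s w L L.+1); rewrite /cyc; try lia.
- by apply: dom; lia.
- by apply: dom; lia.
- by apply: dom; lia.
- by apply/D_rot/extra1_block => //; lia.
- by apply/D312/edge_extra; lia.
Qed.

Lemma extra2_block x w : n = L.+2 -> x < w -> w < L -> D L.+1 x w.
Proof.
move=> nL xw wL; apply/D312.
have [sx|nsx] := boolP (skipped x).
  have [->|wc] := eqVneq w x.+1; first by apply: skip_dom; lia.
  by apply: (@extra2_apex x x.+1) => //; [lia | exact: skip_dom].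
have px : on_path x by rewrite /on_path nsx andbT; lia.
have [|s [ps xs dom sx min]] := path_next px; first lia.
have [sw|ws|sw] := ltngtP s w.
- exact: extra2_apex dom.
(* The path successor of [x] jumps over [w], so [x = w - 1], and the wrap through 0 applies
   again. *)
- have sw : skipped w.
    rewrite -[skipped w]negbK; apply/negP => nsw; suff : s <= w by lia.
    by apply: min => //; rewrite /on_path wL.
  have wx : x = w - 1 by lia.
  have w2 : 1 < w by move: sw; rewrite /skipped; lia.
  rewrite wx; apply/D_rot/extra_pred => //; first lia.
  apply: (@extra2_apex 0 1) => //; first exact: edge1; lia.
- by rewrite -sw; apply: dom; lia.
Qed.

Lemma all_triples x y z : x < n -> y < n -> z < n ->
  x != y -> y != z -> x != z -> D x y z.
Proof.
have sorted_triple a b c : a < b < c -> c < n -> D a b c.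
  move=> abc cn; have [cL|cL] := ltnP c L; first by apply: block_triple; lia.
  have nL : n = L.+2 by lia.
  have [bL|bL] := ltnP b L.
    have [->|->] : c = L \/ c = L.+1 by lia.
    - by apply/D_rot/extra1_block; lia.
    - by apply/D_rot/extra2_block; lia.
  have [-> ->] : b = L /\ c = L.+1 by lia.
  by apply/D312/edge_extra; lia.
move=> xn yn zn xy yz xz.
have [h|h] := ltnP x y; have [h'|h'] := ltnP y z; have [h''|h''] := ltnP x z; try lia.
- by apply: sorted_triple; lia.
- by apply/D_swap/sorted_triple; lia.
- by apply/D_rot/sorted_triple; lia.
- by apply/D213/sorted_triple; lia.
- by apply/D312/sorted_triple; lia.
- by apply/D321/sorted_triple; lia.
Qed.

End Propagation.

Import Order.TTheory GRing.Theory Num.Theory.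
Local Open Scope fset_scope.
Local Open Scope ring_scope.

(** * Cyclic labellings of convex point sets *)

Section Labelling.
Variable R : realType.
Implicit Types (p q r x a b c : 'rV[R]_2) (S : {fset 'rV[R]_2}).

Lemma area2_rot p q r : area2 q r p = area2 p q r.
Proof. by rewrite /area2; ring. Qed.

Lemma area2_swap p q r : area2 p r q = - area2 p q r.
Proof. by rewrite /area2; ring. Qed.

Lemma ccw_rot p q r : ccw q r p = ccw p q r.
Proof. by rewrite /ccw area2_rot. Qed.

Lemma ccw_asym p q r : ccw p q r -> ccw p r q = false.
Proof. by rewrite /ccw area2_swap; lra. Qed.

Lemma ccw_total S p q r : general_position S ->
  p \in S -> q \in S -> r \in S -> uniq [:: p; q; r] ->
  ccw p r q = ~~ ccw p q r.
Proof.
move=> gS pS qS rS u; have := gS _ _ _ pS qS rS u.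
by rewrite /collinear /ccw area2_swap; case: ltgtP => //; lra.
Qed.

(** The barycentric coordinates of [x] are the areas of the triangles that [x] forms with the
    opposite sides, divided by their sum. *)
Lemma triangle_in_hull (A : {fset 'rV[R]_2}) x a b c :
  a \in A -> b \in A -> c \in A ->
  ccw x a b -> ccw x b c -> ccw x c a -> in_convex_hull A x.
Proof.
rewrite /ccw => aA bA cA; set C := area2 x a b; set A' := area2 x b c.
set B := area2 x c a => C0 A0 B0.
pose s := A' + B + C; have s0 : s != 0 by rewrite /s; lra.
(* A point mass [k] at [e]; the weights are a sum of three such masses. *)
pose d (e y : 'rV[R]_2) (k : R) := if y == e then k else 0.
have dsum (V : lmodType R) e k (F : 'rV[R]_2 -> V) : e \in A ->
    \sum_(y <- A) d e y k *: F y = k *: F e.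
  move=> eA; rewrite (bigD1_seq e) ?fset_uniq //= /d eqxx big1 ?addr0 // => y.
  by move/negPf->; rewrite scale0r.
have dsum1 e k : e \in A -> \sum_(y <- A) d e y k = k.
  move=> eA; rewrite (bigD1_seq e) ?fset_uniq //= /d eqxx big1 ?addr0 // => y.
  by move/negPf->.
exists (fun y : 'rV[R]_2 => d a y (A' / s) + d b y (B / s) + d c y (C / s)); split.
- have h k e y : 0 < k -> 0 <= d e y (k / s).
    by rewrite /d; case: ifP => // _ k0; rewrite divr_ge0 /s; lra.
  by move=> y _; rewrite !addr_ge0 ?h.
- by rewrite !big_split /= !dsum1 // -!mulrDl divff.
- under eq_bigr do rewrite !scalerDl.
  rewrite !big_split /= !dsum //.
  have e1 (i : 'I_1) : i = 0 by rewrite ord1.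
  have co (j : 'I_2) : (A' * a 0 j + B * b 0 j + C * c 0 j) = s * x 0 j.
    have [->|->] : j = 0 \/ j = 1.
      by case: j => [[|[|//]]] H; [left|right]; apply/val_inj.
    - by rewrite /s /A' /B /C /area2; ring.
    - by rewrite /s /A' /B /C /area2; ring.
  apply/matrixP => i j; rewrite (e1 i) !mxE.
  rewrite -(mulKf s0 (x 0 j)) -co; field; exact: s0.
Qed.

Lemma no_point_in_triangle S x a b c : convex_position S ->
  x \in S -> a \in S -> b \in S -> c \in S -> uniq [:: x; a; b; c] ->
  ccw x a b -> ccw x b c -> ccw x c a = false.
Proof.
move=> cS xS aS bS cS'; rewrite /= !inE !negb_or -!andbA.
move=> /and4P[xa xb xc _] h1 h2; apply/negP => h3; apply: (cS x xS).
by apply: triangle_in_hull h1 h2 h3; rewrite !inE ?aS ?bS ?cS' andbT eq_sym.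
Qed.

(** Angular sorting around [p0]: totality comes from general position, and a failure of transitivity
    would put [p0] inside a triangle of points of [S]. *)
Lemma convex_sort S p0 : general_position S -> convex_position S -> p0 \in S ->
  exists s : seq 'rV[R]_2, [/\ perm_eq s (S `\ p0) &
    pairwise (fun a b => (a == b) || ccw p0 a b) s].
Proof.
move=> gS cS p0S; set r := fun a b => _.
have ccw0 a b : a \in S `\ p0 -> b \in S `\ p0 -> a != b ->
    ccw p0 b a = ~~ ccw p0 a b.
  rewrite !inE => /andP[ap aS] /andP[bp bS] ab.
  by apply: (ccw_total gS) => //=; rewrite !inE negb_or ab ![p0 == _]eq_sym ap bp.
have tot : {in S `\ p0 &, total r}.
  move=> a b aS bS; rewrite /r [b == a]eq_sym.
  by have [//|ab] := eqVneq a b; rewrite (ccw0 a b aS bS ab) orbN.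
have tr : {in S `\ p0 & &, transitive r}.
  move=> b a c bS aS cS'; rewrite /r.
  have [->//|ab] := eqVneq a b; have [->|bc] := eqVneq b c; first by move=> /= ->; rewrite orbT.
  have [//|ac] := eqVneq a c; rewrite /= (ccw0 c a) // 1?eq_sym // => h1 h2.
  move: aS bS cS'; rewrite !inE => /andP[ap aS] /andP[bp bS] /andP[cp cS'].
  have u : uniq [:: p0; a; b; c].
    by rewrite /= !inE !negb_or ![p0 == _]eq_sym ap bp cp ab ac bc.
  by rewrite (no_point_in_triangle cS p0S aS bS cS' u h1 h2).
exists (sort r (S `\ p0)); split; first by rewrite perm_sort.
have all_s : all (mem (S `\ p0)) (sort r (S `\ p0)).
  by apply/allP => x; rewrite mem_sort.
rewrite -(sorted_pairwise_in tr all_s); apply: (sort_sorted_in tot).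
by apply/allP => x.
Qed.

Lemma convex_enum n S : (0 < n)%N -> convex_point_set n S ->
  exists s : seq 'rV[R]_2, [/\ size s = n, uniq s, s =i S &
    forall i j k, (i < j < k)%N -> (k < n)%N ->
      ccw (nth 0 s i) (nth 0 s j) (nth 0 s k)].
Proof.
move=> n0 [Sn gS cS]; have /fset0Pn[p0 p0S] : S != fset0.
  by rewrite -cardfs_gt0 Sn.
have [s [ps pw]] := convex_sort gS cS p0S.
have us : uniq s by rewrite (perm_uniq ps) fset_uniq.
have memS : p0 :: s =i S.
  by move=> x; rewrite inE (perm_mem ps) !inE; case: eqVneq => [->|].
have p0s : p0 \notin s by rewrite (perm_mem ps) !inE eqxx.
have sz : (size s).+1 = n.
  by rewrite (perm_size ps) -Sn (cardfsD1 p0 S) p0S.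
exists (p0 :: s); split => //; first by rewrite /= p0s.
have lt0 j k : (j < k)%N -> (k < size s)%N -> ccw p0 (nth 0 s j) (nth 0 s k).
  move=> jk ks; have /orP[|//] := (pairwiseP 0 pw) j k (ltn_trans jk ks) ks jk.
  by rewrite nth_uniq //; [lia | exact: ltn_trans ks].
move=> [|i] [|j] [|k] ijk kn; try lia; first by apply: lt0; lia.
have [ij jk ks] : [/\ (i < j)%N, (j < k)%N & (k < size s)%N] by split; lia.
have inS m : (m < size s)%N -> nth 0 s m \in S.
  by move=> ms; rewrite -memS inE mem_nth ?orbT.
have ne m1 m2 : (m1 < m2)%N -> (m2 < size s)%N -> nth 0 s m1 != nth 0 s m2.
  by move=> lt12 lt2; rewrite nth_uniq //; [lia | exact: ltn_trans lt2].
have ne0 m : (m < size s)%N -> p0 != nth 0 s m.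
  by move=> ms; apply: contraNneq p0s => ->; exact: mem_nth.
rewrite /= -[ccw _ _ _]negbK -(ccw_total gS) ?inS //; try lia.
  (* Otherwise [nth 0 s j] would lie inside the triangle of [p0], [nth 0 s i] and [nth 0 s k]. *)
  apply/negP => acb.
  have u : uniq [:: nth 0 s j; p0; nth 0 s i; nth 0 s k].
    rewrite /= !inE !negb_or [_ == p0]eq_sym [_ == nth 0 s i]eq_sym.
    by rewrite !ne0 ?ne //; lia.
  have is' := ltn_trans ij (ltn_trans jk ks); have js := ltn_trans jk ks.
  have := no_point_in_triangle cS (inS j js) p0S (inS i is') (inS k ks) u.
  by rewrite -!(ccw_rot (nth 0 s j)) acb -(ccw_rot (nth 0 s k)) !lt0 // => /(_ isT isT).
by rewrite /= !inE negb_or !ne //; lia.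
Qed.
End Labelling.

(** This fixes the order type: two sets labelled by the same ['I_n] are related by an
    orientation-preserving bijection. *)
Definition cyclic_labelling (R : realType) n (S : {fset 'rV[R]_2}) (f : 'I_n -> S) :=
  bijective f /\ forall i j k, uniq [:: i; j; k] ->
    ccw (val (f i)) (val (f j)) (val (f k)) = cyc i j k.

Lemma convex_labelling (R : realType) n (S : {fset 'rV[R]_2}) :
  (0 < n)%N -> convex_point_set n S -> exists f : 'I_n -> S, cyclic_labelling f.
Proof.
move=> n0 cS; have [s [sz us memS lt]] := convex_enum n0 cS.
have inS (i : 'I_n) : nth 0 s i \in S by rewrite -memS mem_nth ?sz.
pose f i : S := [` inS i]; exists f; split.
  apply: inj_card_bij.
    move=> i j /(congr1 val)/= /eqP; rewrite nth_uniq ?sz // => /eqP.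
    exact: val_inj.
  by rewrite card_ord -cardfE; case: cS => ->.
move=> i j k; rewrite /= !inE negb_or andbT -!(inj_eq val_inj) /=.
have := (ltn_ord i, ltn_ord j, ltn_ord k).
move: (nat_of_ord i) (nat_of_ord j) (nat_of_ord k) => a b c [[an bn] cn] ne.
have [h|h] := boolP (cyc a b c).
  have [h'|[h'|h']] : (a < b < c \/ b < c < a \/ c < a < b)%N.
    by move: h; rewrite /cyc; lia.
  - exact: lt.
  - by rewrite -ccw_rot; exact: lt.
  - by rewrite -ccw_rot -ccw_rot; exact: lt.
apply: ccw_asym.
have [h'|[h'|h']] : (a < c < b \/ c < b < a \/ b < a < c)%N.
  by move: h; rewrite /cyc; lia.
- exact: lt.
- by rewrite -ccw_rot; exact: lt.
- by rewrite -ccw_rot -ccw_rot; exact: lt.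
Qed.

(** * Transport of OT-graphs *)

Lemma derivable_map (V W : eqType) (g : V -> W) T T' : injective g ->
  (forall a b c o, T a b c o -> T' (g a) (g b) (g c) o) ->
  forall a b c o, derivable T a b c o -> derivable T' (g a) (g b) (g c) o.
Proof.
move=> gI TT' a b c o; have u s : uniq (map g s) = uniq s := map_inj_uniq gI s.
elim=> {a b c o}.
- by move=> a b c o /TT'; apply: derivable_given.
- by move=> p q r upqr _; apply: cyclic_symmetry; rewrite -u in upqr.
- by move=> p q r upqr _; apply: antisymmetry; rewrite -u in upqr.
- by move=> p q r upqr _; apply: nondegeneracy; rewrite -u in upqr.
- move=> t p q r us _ h1 _ h2 _ h3; rewrite -u in us; exact: interiority us h1 h2 h3.
- move=> t s p q r us _ h1 _ h2 _ h3 _ h4 _ h5; rewrite -u in us.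
  exact: transitivity us h1 h2 h3 h4 h5.
Qed.

Lemma OT_graph_transfer (R : realType) n (S S' : {fset 'rV[R]_2})
    (f : 'I_n -> S) (f' : 'I_n -> S') (E : {set {set S}}) :
  cyclic_labelling f -> cyclic_labelling f' -> OT_graph E ->
  exists2 E' : {set {set S'}}, OT_graph E' & #|E'| = #|E|.
Proof.
move=> [[g fK gK] fc] [[g' f'K g'K] f'c] [grE derE].
pose h x := f' (g x); pose h' y := f (g' y).
have hK : cancel h h' by move=> x; rewrite /h /h' f'K gK.
have h'K : cancel h' h by move=> x; rewrite /h /h' fK g'K.
have hI := can_inj hK.
have hc a b c : uniq [:: a; b; c] ->
    ccw (val (h a)) (val (h b)) (val (h c)) = ccw (val a) (val b) (val c).
  move=> u; have ug : uniq [:: g a; g b; g c].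
    by rewrite -(map_inj_uniq (can_inj gK)) in u.
  by rewrite f'c // -[a in RHS]gK -[b in RHS]gK -[c in RHS]gK fc.
have him : injective (fun e : {set S} => h @: e) := imset_inj hI.
exists ((fun e : {set S} => h @: e) @: E); last by rewrite card_imset.
split=> [_ /imsetP[e /grE e2 ->]|x y z]; first by rewrite card_imset.
rewrite -[x]h'K -[y]h'K -[z]h'K; move: (h' x) (h' y) (h' z) => a b c u.
have uabc : uniq [:: a; b; c] by rewrite -(map_inj_uniq hI).
rewrite hc //; apply: derivable_map (derE a b c uabc) => //.
move=> {uabc u} {}a {}b {}c o [uabc abc ->]; split.
- by rewrite -(map_inj_uniq hI) in uabc.
- have mem2 p q : ([set h p; h q] \in [set h @: (e : {set S}) | e in E]) = ([set p; q] \in E).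
    by rewrite -imset_set1 -imset_set1 -imsetU mem_imset.
  by rewrite !mem2.
- by rewrite hc.
Qed.

(** * A convex point set on a parabola *)

Section Parabola.
Variables (R : realType) (n : nat).

Definition parabola (i : nat) : 'rV[R]_2 := \row_j (if j == 0 then i%:R else i%:R ^+ 2).

Definition parabola_points : {fset 'rV[R]_2} :=
  seq_fset tt [seq parabola i | i <- iota 0 n].

Lemma mem_parabola x : reflect (exists2 i, (i < n)%N & x = parabola i)
  (x \in parabola_points).
Proof.
rewrite seq_fsetE; apply: (iffP mapP) => -[i]; rewrite ?mem_iota => h ->.
  by exists i.
by exists i; rewrite ?mem_iota.
Qed.

Lemma parabola_inj : injective parabola.
Proof.
move=> i j /(congr1 (fun p : 'rV[R]_2 => p 0 0)); rewrite !mxE /= => /eqP.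
by rewrite eqr_nat => /eqP.
Qed.

(** A Vandermonde determinant in the three abscissas. *)
Lemma area2_parabola i j k : area2 (parabola i) (parabola j) (parabola k) =
  (j%:R - i%:R) * (k%:R - i%:R) * (k%:R - j%:R).
Proof. by rewrite /area2 !mxE /=; ring. Qed.

Lemma parabola_convex : convex_point_set n parabola_points.
Proof.
split.
- rewrite size_seq_fset undup_id ?size_map ?size_iota //.
  by rewrite map_inj_uniq ?iota_uniq //; exact: parabola_inj.
- move=> p q r /mem_parabola[i _ ->] /mem_parabola[j _ ->] /mem_parabola[k _ ->].
  rewrite /= !inE negb_or andbT !(inj_eq parabola_inj) /collinear area2_parabola.
  move=> /andP[/andP[ij ik] jk].
  by rewrite !mulf_eq0 !subr_eq0 !eqr_nat !negb_or ![k == _]eq_sym [j == _]eq_sym ij ik jk.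
move=> p /mem_parabola[m mn ->] [w [w0 w1 wx]].
(* Height above the tangent at [parabola m]: it vanishes there and equals [(i - m) ^ 2 >= 1] at
   every other [parabola i], hence is at least 1 on their convex hull. *)
pose l (x : 'rV[R]_2) := x 0 1 - 2 * m%:R * x 0 0 + m%:R ^+ 2.
set A := parabola_points `\ _ in w0 w1 wx.
have : \sum_(a <- A) w a * l a = l (parabola m).
  rewrite -wx /l !summxE.
  under eq_bigr do rewrite mulrDr mulrBr.
  rewrite big_split sumrB /= -mulr_suml w1 mul1r; congr (_ - _ + _).
    by apply: eq_bigr => a _; rewrite mxE.
  by rewrite mulr_sumr; apply: eq_bigr => a _; rewrite !mxE; ring.
have -> : l (parabola m) = 0 by rewrite /l !mxE /=; ring.
apply/eqP; rewrite gt_eqF // (lt_le_trans ltr01) // -w1 big_seq_cond [leRHS]big_seq_cond.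
apply: ler_sum => a; rewrite andbT => aA; rewrite ler_peMr ?w0 //.
move: aA; rewrite !inE => /andP[am /mem_parabola[i _ ai]].
have im : i != m by apply: contraNneq am => <-; rewrite ai.
have -> : l a = (i%:R - m%:R) ^+ 2 by rewrite ai /l !mxE /=; ring.
have [h|h] : (i.+1 <= m \/ m.+1 <= i)%N by lia.
  by move: h; rewrite -(ler_nat R) -natr1; nra.
by move: h; rewrite -(ler_nat R) -natr1; nra.
Qed.
End Parabola.

(** * The graph *)

Lemma uniq3_rot (V : eqType) (a b c : V) :
  uniq [:: b; c; a] = uniq [:: a; b; c].
Proof. exact: (rot_uniq 1 [:: a; b; c]). Qed.

Lemma uniq3_swap (V : eqType) (a b c : V) :
  uniq [:: a; c; b] = uniq [:: a; b; c].
Proof.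
by rewrite /= !inE !negb_or !andbT [c == b]eq_sym [(a != c) && _]andbC.
Qed.

Section DerivableTriples.
Variables (V : eqType) (T : V -> V -> V -> bool -> Prop).

(** [D_rot] and [D_swap] assume no distinctness although the axioms require it; it is recovered from
    the derivation. *)
Lemma derivable_uniq a b c o : (forall a b c o, T a b c o -> uniq [:: a; b; c]) ->
  derivable T a b c o -> uniq [:: a; b; c].
Proof.
move=> TU; elim=> {a b c o}; first exact: TU.
- by move=> p q r u _ _; rewrite uniq3_rot.
- by move=> p q r u _ _; rewrite uniq3_swap.
- by move=> p q r u _ _; rewrite uniq3_swap.
- by move=> t p q r /=/andP[].
- move=> t s p q r u *.
  exact: (mask_uniq u [:: true; false; true; false; true]).
Qed.

Lemma derivable_swap a b c o : uniq [:: a; b; c] ->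
  derivable T a b c o -> derivable T a c b (~~ o).
Proof. by case: o => u h; [exact: antisymmetry | exact: nondegeneracy]. Qed.

(** A negative triple is swapped into a positive one, rotated twice and swapped back. *)
Lemma derivable_rot a b c o : uniq [:: a; b; c] ->
  derivable T a b c o -> derivable T b c a o.
Proof.
case: o => u; first exact: cyclic_symmetry.
move=> /(derivable_swap u) h.
apply: (@derivable_swap b a c true); first by rewrite uniq3_swap uniq3_rot.
apply: cyclic_symmetry; first by rewrite uniq3_rot uniq3_swap.
by apply: cyclic_symmetry; first rewrite uniq3_swap.
Qed.
End DerivableTriples.

(** Index [2j] gives the edge [(3j, 3j+1)] and [2j+1] gives [(3j+1, 3j+3)]; [minn] matters for the
    last edge when 3 divides [n]. If [n] is 1 mod 3, the last index is diverted to the separate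
    edge. *)
Definition short_edge n i : nat * nat :=
  if (n %% 3 == 1)%N && (i.+1 == 2 * n %/ 3)%N then (n - 2, n - 1)%N
  else (3 * (i %/ 2) + i %% 2, minn (3 * (i %/ 2) + 1 + 2 * (i %% 2)) (n - 1))%N.

Lemma short_edge_lt n i : (4 <= n)%N -> (i < 2 * n %/ 3)%N ->
  ((short_edge n i).1 < (short_edge n i).2 < n)%N.
Proof. by move=> n4 im; rewrite /short_edge; case: ifP => /=; lia. Qed.

Section SmallOTGraph.
Variables (R : realType) (n : nat) (S : {fset 'rV[R]_2}) (f : 'I_n.+1 -> S).
Hypotheses (n_ge4 : (4 <= n.+1)%N) (labelling : cyclic_labelling f).

(** Out of range, [inord] returns 0, hence the bounds in the facts about [pt]. *)
Let pt i := f (inord i).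
Let N := n.+1.

Definition small_graph : {set {set S}} :=
  [set [set pt (short_edge N i).1; pt (short_edge N i).2]
    | i : 'I_(2 * N %/ 3)].

Let pt_eq i j : (i < N)%N -> (j < N)%N -> (pt i == pt j) = (i == j).
Proof.
move=> iN jN; rewrite (inj_eq (bij_inj labelling.1)) -(inj_eq val_inj) /=.
by rewrite !inordK.
Qed.

Let pt_ccw i j k : (i < N)%N -> (j < N)%N -> (k < N)%N -> uniq [:: i; j; k] ->
  ccw (val (pt i)) (val (pt j)) (val (pt k)) = cyc i j k.
Proof.
move=> iN jN kN; rewrite /= !inE => u.
by rewrite labelling.2 ?inordK //= !inE -!(inj_eq val_inj) /= !inordK.
Qed.

Lemma small_graph_OT : OT_graph small_graph.
Proof.
split=> [_ /imsetP[i _ ->]|].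
  have /andP[lt12 lt2] := short_edge_lt n_ge4 (ltn_ord i).
  by rewrite cards2 pt_eq ?(ltn_trans lt12) // ltn_eqF.
set T := given_orientation _.
(* The sign [cyc i j k] is the true orientation: rotation preserves it, and a swap of distinct
   labels negates it. *)
pose D i j k := derivable T (pt i) (pt j) (pt k) (cyc i j k).
have DU i j k : D i j k -> uniq [:: pt i; pt j; pt k].
  by apply: derivable_uniq => a b c o [].
have uN i j k : uniq [:: pt i; pt j; pt k] -> uniq [:: i; j; k].
  exact: (@map_uniq _ _ pt [:: i; j; k]).
have dom x y : (exists2 i, (i < 2 * N %/ 3)%N & short_edge N i = (x, y)) ->
    dominates N D x y.
  move=> [i im exy] w wN wx wy; apply: derivable_given.
  have := short_edge_lt n_ge4 im; rewrite exy /= => /andP[xy yN].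
  have u : uniq [:: x; y; w] by rewrite /= !inE; lia.
  have xN := ltn_trans xy yN; split.
  - by move: u; rewrite /= !inE !pt_eq.
  - by apply/or3P/Or31/imsetP; exists (Ordinal im); rewrite //= exy.
  - by rewrite pt_ccw.
pose L := if (N %% 3 == 1)%N then (N - 2)%N else N.
have all : forall x y z, (x < N)%N -> (y < N)%N -> (z < N)%N ->
    x != y -> y != z -> x != z -> D x y z.
  apply: (@all_triples N L D); rewrite /L.
  - move=> i j k h; rewrite /D (_ : cyc _ _ _ = cyc i j k); last by rewrite /cyc; lia.
    by apply: derivable_rot; rewrite ?DU.
  - move=> i j k h; have /= := uN _ _ _ (DU _ _ _ h); rewrite !inE => u.
    rewrite /D (_ : cyc _ _ _ = ~~ cyc i j k); last by rewrite /cyc; lia.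
    by apply: derivable_swap; rewrite ?DU.
  - move=> t s p q r tN sN pN qN rN c1 c2 c3; rewrite /D.
    have [c4 c5 c6] : [/\ cyc t s q, cyc t s r & cyc t p r].
      by split; move: c1 c2 c3; rewrite /cyc; lia.
    rewrite c1 c2 c3 c4 c5 c6; apply: transitivity.
    have : uniq [:: t; s; p; q; r].
      by move: c1 c2 c3; rewrite /cyc /= !inE; lia.
    by rewrite /= !inE !pt_eq.
  - by case: ifP; lia.
  - by case: ifP; lia.
  - by case: ifP; lia.
  - move=> x x0 xL; apply: dom; exists (2 * (x %/ 3))%N; first by move: xL; case: ifP; lia.
    rewrite /short_edge ifF; last by move: xL; case: ifP; lia.
    by congr pair; move: xL; case: ifP; lia.
  - move=> x x0 xL; apply: dom; exists (2 * (x %/ 3)).+1; first by move: xL; case: ifP; lia.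
    rewrite /short_edge ifF; last by move: xL; case: ifP; lia.
    by congr pair; move: xL; case: ifP; lia.
  - case: ifP => [|N3 N0]; first lia.
    (* The last index is odd here, and [minn] lowers the endpoint [N] to [N - 1]. *)
    apply: dom; exists (2 * N %/ 3 - 1)%N; first lia.
    by rewrite /short_edge N3 /=; congr pair; lia.
  - case: ifP => [N1 _|]; last lia.
    apply: dom; exists (2 * N %/ 3 - 1)%N; first lia.
    rewrite /short_edge ifT; last lia.
    by congr pair; lia.
have [g fK gK] := labelling.1 => a b c.
have ptg x : pt (g x) = x by rewrite /pt inord_val gK.
rewrite -[a]ptg -[b]ptg -[c]ptg => u.
have := uN _ _ _ u; rewrite /= !inE negb_or andbT => /andP[/andP[ab ac] bc].
by rewrite pt_ccw ?uN //; apply: all.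
Qed.
End SmallOTGraph.

Theorem theorem1 (R : realType) (n : nat) (hn : (4 <= n)%N) :
  exists c : nat, is_cn R n c /\ (c <= (2 * n) %/ 3)%N.
Proof.
case: n hn => // n n4; pose S0 := parabola_points R n.+1.
have [f0 lab0] := convex_labelling (ltn0Sn n) (parabola_convex R n.+1).
have OT0 := small_graph_OT n4 lab0.
(* The minimum is taken on the parabola; transfer from it and back to it makes the value the minimum
   for every convex set of this size. *)
case: (@arg_minnP _ (small_graph f0) (fun E => `[< OT_graph E >])
  (fun E => #|E|)) => [|E /asboolP OTE minE]; first exact/asboolP.
exists #|E|; split; last first.
  apply: (leq_trans (minE (small_graph f0) _)); first exact/asboolP.
  by apply: leq_trans (leq_imset_card _ _) _; rewrite card_ord.
split=> [|S cS]; first by exists S0; exact: parabola_convex.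
have [f lab] := convex_labelling (ltn0Sn n) cS.
split; first exact: OT_graph_transfer lab0 lab OTE.
move=> E' /(OT_graph_transfer lab lab0)[E'' OTE'' <-].
by apply: minE; apply/asboolP.
Qed.
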